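(* Let $\psi$ be either $\psi_\omega$ or $\psi_2$ (the Fraïssé limit of finite pseudotrees, respectively of finite binary pseudotrees), let $f$ be an enumerating function for $\psi$, and let $\mathrm{os}$ be the function on pairs of incomparable elements of $\psi$ derived from $f$ as defined in the context. Let $\varphi \in \binom{\psi}{\psi}$. Then for every integer $\ell \geq 1$ there are incomparable $a, b \in \varphi$ such that $\mathrm{os}(a,b) = \ell$. In particular, $\mathrm d(\psi_2 : \mathrm A) = \mathrm d(\psi_\omega : \mathrm A) = \infty$, where $\mathrm A$ is the three element pseudotree consisting of a root and two incomparable nodes.
   Context: A pseudotree is a structure $T$ with a (reflexive, antisymmetric, transitive) order relation $\leq$ and a binary function $\wedge$ such that $\sup\{x \in T : x \leq a,\ x \leq b\} = a \wedge b$ for all $a,b \in T$ (in particular this supremum exists), and such that for each $a \in T$ the set $D_T(a) = \{x \in T : x \leq a\}$ is linearly ordered by $\leq$. A pseudotree $T$ is binary if for every $a \in T$ and $x,y,z > a$ it is not the case that $a = x\wedge y = x \wedge z = y \wedge z$. Finite pseudotrees, and finite binary pseudotrees, with embeddings respecting $\leq$ and $\wedge$, form Fraïssé classes; their Fraïssé limits are $\psi_\omega$ and $\psi_2$ respectively. The symbol $\psi$ also denotes the domain of the structure. For structures $A, B$, $\binom{B}{A}$ is the set of all substructures of $B$ isomorphic to $A$. A natural number $\ell$ is identified with $\{0,\dots,\ell-1\}$, and $g[x]$ denotes the image of the set $x$ under the function $g$. For $\ell \in \omega$ write $B \to (B)^A_\ell$ if for every function $c\colon \binom{B}{A} \to \ell$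 there exists $C \in \binom{B}{B}$ such that $c\left[\binom{C}{A}\right] \neq \ell$ (i.e. some color is omitted). The big Ramsey degree $\mathrm d(B : A)$ of $A$ in $B$ is the smallest $\ell\in\omega$ for which $B \to (B)^A_{\ell+1}$, and $\mathrm d(B:A) = \infty$ if no such $\ell$ exists. A set $R \subset \psi$ is a ray in $\psi$ if either (i) $\inf R$ exists in $\psi$, denoted $o(R)$, and then $o(R)\notin R$ and $R$ is a $\subseteq$-maximal linearly ordered subset of $\psi$ with infimum $o(R)$ (maximal among those not containing $o(R)$); or (ii) $\inf R$ does not exist and $R$ is a $\subseteq$-maximal linearly ordered subset of $\psi$. The set of all rays is $\overline{\mathcal R}$. An enumerating function is a one-to-one function $f\colon \omega \to \psi \cup \overline{\mathcal R}$ such that: (1) $\psi \cap f[n]$ is a pseudotree (a substructure of $\psi$) for each $n \in \omega$; (2) $\psi \subset f[\omega]$; (3) if $f(n) = R \in \overline{\mathcal R}$ and $o(R)$ is defined, then $o(R) \in f[n] \cap \psi$; (4) if $f(n) \in \psi$, then $f(n) \in \bigcup (f[n] \cap \overline{\mathcal R})$; (5) if $n \neq m$ and $f(n), f(m) \in \overline{\mathcal R}$, then $f(n) \cap f(m) = \emptyset$. Such a function exists. Put $\mathcal R = f[\omega] \cap \overline{\mathcal R}$, and let $e\colon \psi \cup \mathcal R \to \omega$ be the bijection inverse to $f$. For $a \in \psi$ let $P(a) = \{R \in \mathcal R : R \cap D_\psi(a) \neq \emptyset\}$ and $p(a) = \{e(R) : R \in P(a)\}$, which is a finite subset of $\omega$.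 For disjoint finite sets $u_0, u_1 \subset \omega$ let $\simeq$ be the equivalence relation on $u_0 \cup u_1$ defined by $n \simeq m$ if there is $i \in \{0,1\}$ such that $m, n \in u_i$ and there is no $k \in u_{1-i}$ such that $n<k<m$ or $m<k<n$. Let $\mathrm{osc}(u_0,u_1)$ be the number of equivalence classes of $\simeq$. For incomparable $a, b \in \psi$ define $\mathrm{os}(a,b) = \mathrm{osc}(p(a) \setminus p(b),\, p(b) \setminus p(a))$. *)

(* Defs.v *)
From mathcomp Require Import all_boot.
From mathcomp Require Import finmap.
From mathcomp Require Import boolp classical_sets functions cardinality.

Set Implicit Arguments.
Unset Strict Implicit.
Unset Printing Implicit Defensive.

Local Open Scope classical_set_scope.

(* The relation and the operation are arbitrary here; the axioms are in
   [pseudotree].  The domain may be empty: the requirement that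
   psi `&` f[0] is a pseudotree only makes sense with this convention. *)
Record omstruct := OMStruct {
  dom :> Type;
  ple : dom -> dom -> Prop;
  pmeet : dom -> dom -> dom }.

Arguments ple {o} _ _.
Arguments pmeet {o} _ _.

Definition plt (T : omstruct) (x y : T) := ple x y /\ x <> y.

Definition incomparable (T : omstruct) (x y : T) := ~ ple x y /\ ~ ple y x.

Definition is_sup (T : omstruct) (X : set T) (s : T) :=
  (forall x, X x -> ple x s) /\
  (forall u, (forall x, X x -> ple x u) -> ple s u).

Definition is_inf (T : omstruct) (X : set T) (s : T) :=
  (forall x, X x -> ple s x) /\
  (forall u, (forall x, X x -> ple u x) -> ple u s).

Definition linearly_ordered (T : omstruct) (X : set T) :=
  total_on X (@ple T).

Definition down (T : omstruct) (a : T) : set T := [set x | ple x a].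

Record pseudotree (T : omstruct) : Prop := Pseudotree {
  ple_refl : forall x : T, ple x x;
  ple_anti : forall x y : T, ple x y -> ple y x -> x = y;
  ple_trans : forall x y z : T, ple x y -> ple y z -> ple x z;
  pmeet_sup : forall a b : T,
    is_sup [set x | ple x a /\ ple x b] (pmeet a b);
  down_linear : forall a : T, linearly_ordered (down a) }.

Definition binary (T : omstruct) :=
  forall a x y z : T, plt a x -> plt a y -> plt a z ->
    ~ [/\ a = pmeet x y, a = pmeet x z & a = pmeet y z].

Definition substructure (T : omstruct) (X : set T) :=
  forall x y, X x -> X y -> X (pmeet x y).

Definition generated (T : omstruct) (F : set T) : set T :=
  smallest (@substructure T) F.

Definition finitely_generated (T : omstruct) (X : set T) :=
  exists F : set T, finite_set F /\ X = generated F.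

(* When X is a substructure of S: g restricts to an isomorphism from X onto
   the substructure g @` X of T. *)
Definition embedding_on (S T : omstruct) (X : set S) (g : S -> T) :=
  forall x y, X x -> X y ->
    [/\ g x = g y -> x = y,
        ple (g x) (g y) <-> ple x y
      & g (pmeet x y) = pmeet (g x) (g y)].

Definition embedding (S T : omstruct) (g : S -> T) := embedding_on setT g.

Definition automorphism (T : omstruct) (h : T -> T) :=
  embedding h /\ range h = setT.

Definition homogeneous (M : omstruct) :=
  forall (X : set M) (g : M -> M),
    finitely_generated X -> embedding_on X g ->
    exists h : M -> M, automorphism h /\ forall x, X x -> h x = g x.

(* The age of M: the finitely generated structures embeddable in M. *)
Definition age (M A : omstruct) :=
  finitely_generated [set: A] /\ exists g : A -> M, embedding g.

Definition fraisse_limit (K : omstruct -> Prop) (M : omstruct) :=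
  [/\ countable [set: M], forall A, K A <-> age M A & homogeneous M].

Definition finite_pseudotree (A : omstruct) :=
  finite_set [set: A] /\ pseudotree A.

Definition finite_binary_pseudotree (A : omstruct) :=
  finite_pseudotree A /\ binary A.

(* Fraisse limits are unique up to isomorphism, so psi_omega and psi_2 are
   treated as any structures with these properties. *)
Definition is_psi_omega (psi : omstruct) :=
  fraisse_limit finite_pseudotree psi.

Definition is_psi_2 (psi : omstruct) :=
  fraisse_limit finite_binary_pseudotree psi.

(* binom(C, A), for C a substructure of B: the substructures of B contained
   in C that are isomorphic to A, i.e. the ranges of embeddings A -> C.
   In particular binom(B, A) is [copies A [set: B]]. *)
Definition copies (A B : omstruct) (C : set B) : set (set B) :=
  [set X | X `<=` C /\ exists g : A -> B, embedding g /\ range g = X].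

(* A colouring binom(B, A) -> l is a function c on all subsets of B whose
   values on binom(B, A) lie in l = {0, ..., l - 1}; its other values are
   irrelevant. *)
Definition arrow (B A : omstruct) (l : nat) :=
  forall c : set B -> nat,
    (forall X, copies A [set: B] X -> (c X < l)%N) ->
    exists C : set B, copies B [set: B] C /\ c @` copies A C <> `I_l.

(* [None] stands for infinity. *)
Definition big_ramsey_degree (B A : omstruct) : option nat :=
  match pselect (exists l, `[< arrow B A l.+1 >]) with
  | left h => Some (ex_minn h)
  | right _ => None
  end.

(* The root [None] with two incomparable nodes [Some false], [Some true]. *)
Definition three_tree : omstruct := {|
  dom := option bool;
  ple := fun x y => x = None \/ x = y;
  pmeet := fun x y => if x == y then x else None |}.

Definition maximal_in (T : Type) (Q : set (set T)) (R : set T) :=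
  Q R /\ forall S, Q S -> R `<=` S -> S = R.

Definition ray (psi : omstruct) (R : set psi) :=
  (exists o : psi, is_inf R o /\
     maximal_in [set S | [/\ linearly_ordered S, is_inf S o & ~ S o]] R)
  \/
  (~ (exists o : psi, is_inf R o) /\ maximal_in (@linearly_ordered psi) R).

(* A point x of psi is encoded as [inl x], a ray R as [inr R]. *)
Record enumerating (psi : omstruct) (f : nat -> psi + set psi) : Prop :=
  Enumerating {
  enum_ray : forall n R, f n = inr R -> ray R;
  enum_inj : injective f;
  enum_substructure : forall n : nat,
    substructure [set x | (f @` `I_n) (inl x)];
  enum_onto : forall x : psi, range f (inl x);
  enum_inf : forall n R o, f n = inr R -> is_inf R o ->
    (f @` `I_n) (inl o);
  enum_cover : forall n x, f n = inl x ->
    exists R, (f @` `I_n) (inr R) /\ R x;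
  enum_disjoint : forall n m R S, n <> m -> f n = inr R -> f m = inr S ->
    R `&` S = set0 }.

Definition osc_equiv (u0 u1 : set nat) (n m : nat) :=
  let u (i : bool) := if i then u1 else u0 in
  exists i : bool, [/\ u i m, u i n &
    ~ exists k, u (~~ i) k /\ ((n < k < m)%N \/ (m < k < n)%N)].

Definition osc (u0 u1 : set nat) : nat :=
  #|` fset_set [set [set m | osc_equiv u0 u1 n m] | n in u0 `|` u1] |.

(* The inverse of f (0 outside the range of f). *)
Definition enum_index (psi : omstruct) (f : nat -> psi + set psi)
    (z : psi + set psi) : nat :=
  xget 0%N [set n | f n = z].

Definition Prays (psi : omstruct) (f : nat -> psi + set psi) (a : psi) :
    set (set psi) :=
  [set R | range f (inr R) /\ R `&` down a !=set0].

Definition pset (psi : omstruct) (f : nat -> psi + set psi) (a : psi) :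
    set nat :=
  [set enum_index f (inr R) | R in Prays f a].

(* Meaningful only for incomparable a and b. *)
Definition os (psi : omstruct) (f : nat -> psi + set psi) (a b : psi) :
    nat :=
  osc (pset f a `\` pset f b) (pset f b `\` pset f a).

(* Main.v *)
Require Import Defs.
From mathcomp Require Import all_boot.
From mathcomp Require Import finmap.
From mathcomp Require Import boolp classical_sets functions cardinality.

(** Let [r] send a point to the index of the ray containing it, so that p(a)
    is the set of labels [r s] of the points [s <= a]. The proof only uses
    that equally labelled points are comparable, that the label classes are
    convex, and that the points below any given point have bounded labels.

    Let [g] be an embedding with image phi. Call [y] good if p takes the
    same value at [g y] and at [g d] for some [d > y]; since p is finite and
    the order is dense, there are good points above every point. If [y] is
    good, then infinitely many branches leave the interval from [y] to [d],
    and no new label occurs above two of them, so that for every [N] some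
    branch only produces new labels [>= N]. Starting from incomparable good
    [a] and [b] such that p(g a) \ p(g b) contains the largest element of
    the symmetric difference, one may thus move [b] up to a good point whose
    new labels exceed everything in p(g a) and p(g b). This increases the
    oscillation by exactly 1 and exchanges the roles of [a] and [b].

    For the big Ramsey degrees no rays are needed: relative to an
    enumeration of the tree, the least index of a point above [y] is such a
    label of [y]. *)

Set Implicit Arguments.
Unset Strict Implicit.
Unset Printing Implicit Defensive.

Local Open Scope classical_set_scope.

(** * Oscillation of pairs of sets of natural numbers *)

Lemma osc_equivC (u0 u1 : set nat) : osc_equiv u0 u1 = osc_equiv u1 u0.
Proof.
suff H v0 v1 n m : osc_equiv v0 v1 n m -> osc_equiv v1 v0 n m.
  by apply/funext => n; apply/funext => m; apply/propext; split; exact: H.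
move=> [[] [vm vn H]].
  by exists false; split => // -[k]; apply: (contra_not _ H) => ?; exists k.
by exists true; split => // -[k]; apply: (contra_not _ H) => ?; exists k.
Qed.

Lemma oscC (u0 u1 : set nat) : osc u0 u1 = osc u1 u0.
Proof. by rewrite /osc osc_equivC setUC. Qed.

Lemma osc0 : osc set0 set0 = 0.
Proof. by rewrite /osc setU0 image_set0 fset_set0 cardfs0. Qed.

(** Every element of [u1] is separated from [w] by an element of [u0], while no element of [u0] lies
    between two elements of [w]. So the old classes persist and [w] is one new class. *)
Lemma osc_extend (u0 u1 w : set nat) (N : nat) :
  (forall n, u0 n -> n < N) -> (forall n, u1 n -> n < N) ->
  u0 `&` u1 = set0 ->
  (forall n, u1 n -> exists2 M, u0 M & n < M) ->
  finite_set w -> w !=set0 -> (forall n, w n -> N <= n) ->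
  osc u0 (u1 `|` w) = (osc u0 u1).+1.
Proof.
move=> u0N u1N u01 u1u0 wfin [w1 ww1] Nw.
have disj n : u0 n -> u1 n -> False.
  by move=> ? ?; have : (u0 `&` u1) n by []; rewrite u01.
have old n : (u0 `|` u1) n -> n < N by case=> [/u0N|/u1N].
have finu : finite_set (u0 `|` u1).
  by apply: (@sub_finite_set _ _ `I_N); [exact: old|exact: finite_II].
have clsw n : w n -> osc_equiv u0 (u1 `|` w) n = w.
  move=> wn; apply/seteqP; split => m /=.
    move=> [[] [/= um un H]]; last by have := u0N _ un; rewrite ltnNge Nw.
    case: um => // um; have [M u0M mM] := u1u0 _ um.
    case: H; exists M; split => //; right; rewrite mM /=.
    exact: leq_trans (u0N _ u0M) (Nw _ wn).
  move=> wm; exists true; split; [by right|by right|].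
  move=> [k [/= /u0N kN]] [] /andP[].
    by move=> nk _; have := Nw _ wn; rewrite leqNgt (ltn_trans nk).
  by move=> mk _; have := Nw _ wm; rewrite leqNgt (ltn_trans mk).
have cls n : (u0 `|` u1) n ->
    osc_equiv u0 (u1 `|` w) n = osc_equiv u0 u1 n.
  move=> un; have nN := old _ un.
  apply/seteqP; split => m [[] [/= vm vn H]].
  - have {}vn : u1 n by case: vn => // /Nw; rewrite leqNgt nN.
    have {}vm : u1 m.
      case: vm => // wm; have [M u0M nM] := u1u0 _ vn.
      case: H; exists M; split => //; left; rewrite nM /=.
      exact: leq_trans (u0N _ u0M) (Nw _ wm).
    by exists true; split.
  - exists false; split => // -[k [/= u1k kk]]; apply: H.
    by exists k; split; [left|].
  - by exists true; split => //=; left.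
  - exists false; split => // -[k [/= [u1k|wk] kk]].
      by apply: H; exists k.
    have := Nw _ wk; rewrite leqNgt.
    by case: kk => /andP[_ kk]; rewrite (ltn_trans kk) ?u0N.
rewrite /osc.
set A := [set _ | _ in u0 `|` u1].
have -> : [set [set m | osc_equiv u0 (u1 `|` w) n m] | n in u0 `|` (u1 `|` w)]
   = w |` A.
  apply/seteqP; split => [_ [n + <-]|v].
    rewrite setUA => -[un|wn].
      by right; exists n => //=; exact/esym/cls.
    by left; exact: clsw.
  case=> [->|[n un <-]].
    by exists w1; [right; right|exact: clsw].
  exists n; last exact: cls.
  by rewrite setUA; left.
have finA : finite_set A by exact: finite_image.
rewrite fset_setU1 // cardfsU1 in_fset_set //.
case: (boolP (w \in A)) => //; rewrite inE => -[n un clsn].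
have : w w1 by []; rewrite -clsn => -[i [um _ _]].
have : (u0 `|` u1) w1 by case: i um => um; [right|left].
by move=> /old; rewrite ltnNge Nw.
Qed.

(** * Order facts in pseudotrees *)

Section Pseudotree.
Variables (T : omstruct) (pT : pseudotree T).
Implicit Types x y z : T.

Lemma pmeet_lel {x y} : ple (pmeet x y) x.
Proof.
by have [_] := pmeet_sup pT x y; apply => z [].
Qed.

Lemma pmeet_ler {x y} : ple (pmeet x y) y.
Proof.
by have [_] := pmeet_sup pT x y; apply => z [].
Qed.

Lemma ple_meet {x y z} : ple z x -> ple z y -> ple z (pmeet x y).
Proof. by have [+ _] := pmeet_sup pT x y => H ? ?; apply: H. Qed.

Lemma ple_meet_eq {x y} : ple x y -> pmeet x y = x.
Proof.
move=> xy; apply: (ple_anti pT) pmeet_lel (ple_meet (ple_refl pT x) xy).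
Qed.

Lemma pmeetC x y : pmeet x y = pmeet y x.
Proof.
by apply: (ple_anti pT); apply: ple_meet;
   (exact: pmeet_lel || exact: pmeet_ler).
Qed.

Lemma plt_nge {x y} : plt x y -> ~ ple y x.
Proof. by move=> [xy nxy] yx; apply/nxy/(ple_anti pT). Qed.

Lemma plt_trans {x y z} : plt x y -> plt y z -> plt x z.
Proof.
move=> [xy nxy] yz; split; first exact: (ple_trans pT) xy yz.1.
by move=> xz; apply: (plt_nge yz); rewrite -xz.
Qed.

End Pseudotree.

(** * Embeddings, dense branching and labellings *)

Lemma embedding_ple (S T : omstruct) (g : S -> T) : embedding g ->
  forall x y, ple (g x) (g y) <-> ple x y.
Proof. by move=> eg x y; have [] := eg x y I I. Qed.

Lemma embedding_meet (S T : omstruct) (g : S -> T) : embedding g ->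
  forall x y, g (pmeet x y) = pmeet (g x) (g y).
Proof. by move=> eg x y; have [] := eg x y I I. Qed.

Lemma embedding_inj (S T : omstruct) (g : S -> T) : embedding g -> injective g.
Proof. by move=> eg x y; have [] := eg x y I I. Qed.

(** This is how genericity of the Fraïssé limit enters the oscillation argument; the branching point
    [c] also gives density. *)
Definition densely_branching (T : omstruct) := forall b d : T, plt b d ->
  exists c x, [/\ plt b c, plt c d, pmeet x d = c & ~ ple x d].

Record labelling (T : omstruct) (r : T -> nat) : Prop := Labelling {
  label_chain : forall x y, r x = r y -> ple x y \/ ple y x;
  label_convex : forall x y z, ple x y -> ple y z -> r x = r z -> r y = r z;
  label_bounded : forall a, exists N, forall s, ple s a -> r s < N }.

Definition labels (T : omstruct) (r : T -> nat) (a : T) : set nat :=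
  [set r s | s in Defs.down a].

(** * Oscillation between label sets of points in an embedded copy *)

Section Oscillation.
Variables (T : omstruct) (r : T -> nat) (g : T -> T).
Hypotheses (pT : pseudotree T) (bT : densely_branching T).
Hypotheses (lr : labelling r) (eg : embedding g).
Implicit Types b c d x y z w : T.

Let q y := labels r (g y).

Let good y := exists2 d, plt y d & q y = q d.

Let g_le {x y} : ple (g x) (g y) <-> ple x y.
Proof. exact: embedding_ple. Qed.

Let q_mono {x y} : ple x y -> q x `<=` q y.
Proof.
move=> xy _ [s sx <-]; exists s => //.
by apply: (ple_trans pT) sx _; exact/g_le.
Qed.

Let q_between {x y z} : q x = q z -> ple x y -> ple y z -> q x = q y.
Proof.
move=> xz xy yz; apply/seteqP; split; first exact: q_mono.
by rewrite xz; exact: q_mono.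
Qed.

Let q_bounded y : exists N, forall n, q y n -> n < N.
Proof.
have [N HN] := label_bounded lr (g y).
by exists N => _ [s /HN + <-].
Qed.

(** Labels are settled from the top down by an intermediate point [c]: if the label occurs at [c],
    continue above [c], otherwise below [c]. Once all are settled, [q] agrees at both ends of the
    interval. *)
Let good_above y w : plt y w -> exists2 z, ple y z & good z.
Proof.
have [N] := q_bounded w.
(* The bound is only required of labels outside [q y], so that the induction can absorb a label by
   raising [y]. *)
have : forall n, q w n -> n < N -> q y n \/ n < N by right.
move=> H HN; have {H HN} : forall n, q w n -> q y n \/ n < N.
  by move=> n qn; right; exact: HN.
elim: N y w => [|N IH] y w qN yw.
  exists y; first exact: (ple_refl pT).
  exists w => //; apply/seteqP; split; first exact: q_mono yw.1.
  by move=> n /qN[].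
have [c [x [yc cw _ _]]] := bT yw.
have [qcN|qcN] := pselect (q c N).
  have [|z cz gz] := IH c w _ cw.
    move=> n /qN[/(q_mono yc.1)|]; first by left.
    by rewrite ltnS leq_eqVlt => /predU1P[->|]; [left|right].
  by exists z => //; exact: (ple_trans pT) yc.1 cz.
apply: (IH y c) => // n qn; have [|] := qN n (q_mono cw.1 qn); first by left.
rewrite ltnS leq_eqVlt => /predU1P[nN|]; last by right.
by move: qn; rewrite nN.
Qed.

(* If two branches [x] and [x'] both reached the label [N] outside [q y], then
   by comparability a point labelled [N] would lie below their meet. *)
Let branch_off N y d : plt y d -> q y = q d ->
  exists c x w, [/\ plt y c, plt c d, pmeet x d = c, ~ ple x d & plt x w] /\
    forall z n, ple x z -> q z n -> ~ q y n -> N <= n.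
Proof.
elim: N y d => [|N IH] y d yd qyd.
  have [c [x [yc cd xdc xd]]] := bT yd.
  have cx : plt c x.
    split; first by rewrite -xdc; exact: pmeet_lel.
    by move=> cx; apply: xd; rewrite -cx; exact: cd.1.
  (* By density [v] can replace [x] as the branch, leaving [x] as the point strictly above it. *)
  have [v [_ [cv vx _ _]]] := bT cx.
  exists c, v, x; split => //; split => //.
    apply: (ple_anti pT); last exact: ple_meet cv.1 cd.1.
    rewrite -xdc; apply: ple_meet => //; last exact: pmeet_ler.
    exact: (ple_trans pT) (pmeet_lel pT) vx.1.
  move=> vd; apply: (plt_nge pT cv).
  by rewrite -xdc; apply: ple_meet => //; exact: vx.1.
have [c [x [w [[yc cd xdc xd xw] Hx]]]] := IH _ _ yd qyd.
have [HN|] := pselect (forall z n, ple x z -> q z n -> ~ q y n -> N.+1 <= n).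
  by exists c, x, w.
move=> /existsNP[z /existsNP[n]].
move=> /not_implyP[xz /not_implyP[qzn /not_implyP[qyn]]].
move=> /negP; rewrite -ltnNge ltnS => nN.
have {nN}nN : n = N by apply/eqP; rewrite eqn_leq nN (Hx z).
subst n.
have qyc := q_between qyd yc.1 cd.1.
(* When the branch at [c] reaches the label [N], a branch leaving strictly between [c] and [d]
   avoids it. *)
have [c' [x' [w' [[cc' c'd x'dc' x'd x'w'] Hx']]]] :=
  IH c d cd (etrans (esym qyc) qyd).
exists c', x', w'; split; first by split => //; exact: plt_trans cc'.
move=> z' n x'z' qz'n qyn'; rewrite ltn_neqAle (Hx' z') -?qyc // andbT.
apply/eqP => Nn; subst n.
have c'z' : ple c' z'.
  by apply: (ple_trans pT) x'z'; rewrite -x'dc'; exact: pmeet_lel.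
have [m [mz mz' rm]] : exists m, [/\ ple m (g z), ple m (g z') & r m = N].
  move: qzn qz'n => [s sz rs] [s' sz' rs'].
  have [ss'|s's] := label_chain lr (etrans rs (esym rs')).
    by exists s; split => //; exact: (ple_trans pT) ss' sz'.
  by exists s'; split => //; exact: (ple_trans pT) s's sz.
(* If [m] were below [g c'], its label [N] would lie in [q d = q y]; so [g c'] is below [m]. Then
   [c'] and [x] are comparable below [z], against the choice of [x]. *)
have c'z : ple c' z.
  apply/g_le; apply: (ple_trans pT) mz.
  have [mc'|//] := down_linear pT mz' (g_le.2 c'z').
  case: qyn; rewrite qyd; apply: (q_mono c'd.1).
  by exists m.
have [xc'|c'x] := down_linear pT xz c'z.
  by apply: xd; exact: (ple_trans pT) xc' c'd.1.
apply: (plt_nge pT cc'); rewrite -xdc; exact: ple_meet c'd.1.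
Qed.

(** Otherwise [r (g x)] and [r (g d)] both occur below [g y], hence by convexity both equal
    [r (g c)], and [x] and [d] would be comparable. *)
Let branch_new y d c x : q y = q d -> plt y c -> plt c d -> pmeet x d = c ->
  ~ ple x d -> ~ q y (r (g x)).
Proof.
move=> qyd yc cd xdc xd [s sy rs].
have cx : ple c x by rewrite -xdc; exact: pmeet_lel.
have [t ty rt] : q y (r (g d)).
  by rewrite qyd; exists (g d) => //; exact: (ple_refl pT).
have gyc : ple (g y) (g c) := g_le.2 yc.1.
have rcx := label_convex lr (ple_trans pT sy gyc) (g_le.2 cx) rs.
have rcd := label_convex lr (ple_trans pT ty gyc) (g_le.2 cd.1) rt.
have [/g_le //|/g_le dx] := label_chain lr (etrans (esym rcx) rcd).
by apply: (plt_nge pT cd); rewrite -xdc; exact: ple_meet (ple_refl pT d).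
Qed.

(** The point [e] stays on the stem below [d] and keeps the labels of [y]; [z] is a good point above
    the branch. Both start the induction on the oscillation, and [z] alone continues it. *)
Let fork_good N y : good y ->
  exists e z, [/\ good e, good z & incomparable e z] /\
    [/\ ple y z, q e = q y, (q z `\` q y) !=set0 &
        forall n, (q z `\` q y) n -> N <= n].
Proof.
move=> [d yd qyd].
have [c [x [w [[yc cd xdc xd xw] HN]]]] := branch_off N yd qyd.
have [e [_ [ce ed _ _]]] := bT cd.
have [z xz gz] := good_above xw.
have ye : plt y e := plt_trans pT yc ce.
have qye := q_between qyd ye.1 ed.1.
exists e, z; split; split => //.
- by exists d => //; rewrite -qye.
- split=> [ez|ze].
    have [ex|xe] := down_linear pT ez xz.
      by apply: (plt_nge pT ce); rewrite -xdc; exact: ple_meet ed.1.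
    by apply: xd; exact: (ple_trans pT) xe ed.1.
  by apply: xd; exact: (ple_trans pT) (ple_trans pT xz ze) ed.1.
- apply: (ple_trans pT) yc.1 (ple_trans pT _ xz).
  by rewrite -xdc; exact: pmeet_lel.
- exists (r (g x)); split; last exact: (branch_new qyd yc cd xdc xd).
  by exists (g x) => //; exact: (g_le.2 xz).
- by move=> n [qzn qyn]; exact: (HN _ _ xz qzn qyn).
Qed.

Let finite_q y : finite_set (q y).
Proof.
have [N HN] := q_bounded y.
by apply: (@sub_finite_set _ _ `I_N); [exact: HN|exact: finite_II].
Qed.

(** The last clause is the invariant that makes [osc_extend] applicable to the next branch above
    [b]. *)
Let osc_good l : (exists b d, @plt T b d) ->
  exists a b, [/\ good a, good b & incomparable a b] /\
    osc (q a `\` q b) (q b `\` q a) = l.+1 /\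
    (forall n, (q b `\` q a) n -> exists2 M, (q a `\` q b) M & n < M).
Proof.
move=> [b0 [d0 bd0]].
elim: l => [|l [a [b [[ga gb iab] [oab Mab]]]]].
  have [y _ gy] := good_above bd0.
  have [e [z [[ge gz [iez ize]] [yz qey qz _]]]] := fork_good 0 gy.
  have qez : q e `\` q z = set0.
    by rewrite -subset0 qey => n [/(q_mono yz)].
  exists z, e; split; first by split.
  rewrite qez; split => //; rewrite oscC.
  (* The first class is added to two empty sets, so the bound [0] is enough. *)
  rewrite -[q z `\` q e]set0U (@osc_extend _ _ _ 0) ?osc0 ?set0I // qey //.
  exact/finite_setD/finite_q.
have [N1 aN] := q_bounded a; have [N2 bN] := q_bounded b.
pose N := maxn N1 N2.
have {}aN n : q a n -> n < N by move=> /aN ?; rewrite leq_max; apply/orP; left.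
have {}bN n : q b n -> n < N by move=> /bN ?; rewrite leq_max; apply/orP; right.
have [_ [z [[_ gz _] [bz _ qz zN]]]] := fork_good N gb.
(* The new labels of [z] exceed all labels of [a], so the side of [a] is unchanged and that of [b]
   only grows. *)
have qaz : q a `\` q z = q a `\` q b.
  apply/seteqP; split => n [an nn]; split => // zn; apply: nn.
    exact: q_mono zn.
  have [//|bn] := pselect (q b n).
  by have := zN n (conj zn bn); rewrite leqNgt aN.
have qza : q z `\` q a = (q b `\` q a) `|` (q z `\` q b).
  apply/seteqP; split => n.
    by move=> [zn an]; have [bn|bn] := pselect (q b n); [left|right].
  case=> [[bn an]|[zn bn]]; first by split => //; exact: q_mono bn.
  by split => // /aN; rewrite ltnNge zN.
(* The roles are exchanged because the largest label now belongs to [z]. *)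
exists z, a; split; last split.
- split => //; split.
    by move=> za; apply: iab.2; exact: (ple_trans pT) bz za.
  by move=> az; case: (down_linear pT az bz) => ?; [apply: iab.1|apply: iab.2].
- rewrite oscC qaz qza (@osc_extend _ _ _ N) ?oab //.
  + by move=> n [/aN].
  + by move=> n [/bN].
  + by rewrite -subset0 => n [[? ?] []].
  + exact/finite_setD/finite_q.
- rewrite qaz => n [/aN nN _]; have [M zM] := qz; exists M.
    by rewrite qza; right.
  exact: leq_trans nN (zN _ zM).
Qed.

Lemma osc_labels l : (exists b d, @plt T b d) -> 1 <= l ->
  exists x y, incomparable (g x) (g y) /\
    osc (labels r (g x) `\` labels r (g y))
        (labels r (g y) `\` labels r (g x)) = l.
Proof.
case: l => // l neT _.
have [x [y [[_ _ [xy yx]] [oxy _]]]] := osc_good l neT.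
by exists x, y; split => //; split => /g_le.
Qed.

End Oscillation.

(** * Labellings from countability and from enumerating functions *)

Lemma countable_labelling (T : omstruct) : pseudotree T ->
  countable [set: T] -> exists r : T -> nat, labelling r.
Proof.
move=> pT /countable_injP[code codeI].
have ex y : exists n, `[< exists2 x, code x = n & ple y x >].
  by exists (code y); apply/asboolP; exists y => //; exact: (ple_refl pT).
(* A larger point has fewer points above it, so [r] is monotone, which gives convexity and
   boundedness. Equally labelled points lie below a common point, hence are comparable. *)
pose r y := ex_minn (ex y).
have rP y : exists2 x, code x = r y & ple y x.
  by rewrite /r; case: ex_minnP => n /asboolP.
have r_mono x y : ple x y -> r x <= r y.
  move=> xy; have [z zr yz] := rP y; rewrite /r.
  case: ex_minnP => n _; apply; apply/asboolP; exists z => //.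
  exact: (ple_trans pT) xy yz.
exists r; split.
- move=> x y rxy; have [u ux xu] := rP x; have [v vy yv] := rP y.
  have uv : u = v by apply: codeI; rewrite ?inE // ux rxy vy.
  by subst v; exact: (down_linear pT xu yv).
- move=> x y z /r_mono xy /r_mono yz rxz.
  by apply/eqP; rewrite eqn_leq yz -rxz.
- by move=> a; exists (r a).+1 => s /r_mono.
Qed.

(** The downward closure of a ray, without the points below the infimum if there is one, is still a
    competitor in the definition of a ray; maximality makes it equal to the ray. *)
Lemma ray_down (T : omstruct) (R : set T) a s : pseudotree T -> ray R ->
  R a -> ple s a -> R s \/ exists o, [/\ is_inf R o, ~ R o & ple s o].
Proof.
move=> pT + Ra sa; case.
  move=> [o [infR [[linR _ Ro] maxR]]].
  have [so|so] := pselect (ple s o); [by right; exists o|left].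
  pose S := [set w | exists2 x, R x & ple w x /\ ~ ple w o].
  suff <- : S = R by exists a.
  apply: maxR.
    split.
    - move=> v w [x Rx [vx _]] [y Ry [wy _]].
      have [xy|yx] := linR _ _ Rx Ry.
        by apply: (down_linear pT) wy; exact: (ple_trans pT) vx xy.
      by apply: (down_linear pT) vx _; exact: (ple_trans pT) wy yx.
    - split.
        move=> w [x Rx [wx wo]].
        by have [//|] := down_linear pT (infR.1 _ Rx) wx.
      move=> u uS; apply: infR.2 => x Rx; apply: uS.
      exists x => //; split; first exact: (ple_refl pT).
      by move=> xo; apply: Ro; rewrite (ple_anti pT (infR.1 _ Rx) xo).
    - by move=> [x Rx [_]]; apply; exact: (ple_refl pT).
  move=> x Rx; exists x => //; split; first exact: (ple_refl pT).
  by move=> xo; apply: Ro; rewrite (ple_anti pT (infR.1 _ Rx) xo).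
move=> [_ [linR maxR]]; left.
pose S := [set w | exists2 x, R x & ple w x].
suff <- : S = R by exists a.
apply: maxR => [v w [x Rx vx] [y Ry wy]|x Rx]; last first.
  by exists x => //; exact: (ple_refl pT).
have [xy|yx] := linR _ _ Rx Ry.
  by apply: (down_linear pT) wy; exact: (ple_trans pT) vx xy.
by apply: (down_linear pT) vx _; exact: (ple_trans pT) wy yx.
Qed.

Lemma ray_linear (T : omstruct) (R : set T) : ray R -> linearly_ordered R.
Proof. by case=> [[o [_ [[]]]]|[_ []]]. Qed.

Lemma enumerating_labelling (T : omstruct) (f : nat -> T + set T) :
  pseudotree T -> enumerating f ->
  exists2 r : T -> nat, labelling r & forall a, pset f a = labels r a.
Proof.
move=> pT ef.
have fI := enum_inj ef.
have ex x : exists nR, f nR.1 = inr nR.2 /\ nR.2 x.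
  have [n _ fn] := enum_onto ef x.
  by have [R [[m _ fm] Rx]] := enum_cover ef fn; exists (m, R).
have [F FP] := choice ex.
pose r x := (F x).1; pose R x := (F x).2.
have fr x : f (r x) = inr (R x) by have [] := FP x.
have Rx x : R x x by have [] := FP x.
have rE n S x : f n = inr S -> S x -> r x = n.
  move=> fn Sx; apply: contrapT => nr.
  have : (R x `&` S) x by [].
  by rewrite (enum_disjoint ef nr (fr x) fn).
have sameR x y : r x = r y -> R x = R y.
  by move=> rxy; have := fr x; rewrite rxy fr => -[].
have rayR x : ray (R x) := enum_ray ef (fr x).
(* Strong induction on [r a]: a point [s] outside the ray of [a] lies below its infimum [o], which
   is enumerated before that ray and covered by a still earlier one, so [r o < r a]. *)
have bound a s : ple s a -> r s <= r a.
  have [n] := ubnP (r a); elim: n a => // n IH a; rewrite ltnS => ran sa.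
  have [Rs|[o [infR _ so]]] := ray_down pT (rayR a) (Rx a) sa.
    by rewrite (rE _ _ _ (fr a) Rs).
  have [m /= mra fm] := enum_inf ef (fr a) infR.
  have [S [[k /= km fk] So]] := enum_cover ef fm.
  have ro := rE _ _ _ fk So.
  have roa : r o < r a by rewrite ro; exact: ltn_trans mra.
  by apply: leq_trans (ltnW roa); apply: IH => //; exact: leq_trans ran.
exists r; first split.
- move=> x y /sameR rxy; apply: (ray_linear (rayR x)) => //.
  by rewrite rxy.
- move=> x y z xy yz rxz.
  by apply/eqP; rewrite eqn_leq bound //= -rxz bound.
- by move=> a; exists (r a).+1 => s /bound.
move=> a; apply/seteqP; split.
  move=> _ [S [[n _ fn] [s [Ss sa]]] <-]; exists s => //.
  rewrite (rE _ _ _ fn Ss) /enum_index.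
  by case: xgetP => [m _ fm|/(_ n)/(_ fn) []]; apply: fI; rewrite fm fn.
move=> _ [s sa <-]; exists (R s).
  by split; [exists (r s)|exists s].
rewrite /enum_index.
by case: xgetP => [m _ fm|/(_ (r s))/(_ (fr s)) []]; apply: fI; rewrite fm fr.
Qed.

(** * Generated substructures and the pseudotree axioms in Fraïssé limits *)

Section Generated.
Variables (M : omstruct) (F : set M).

Lemma generated_substructure : substructure (generated F).
Proof.
by move=> x y Gx Gy Y YF; apply: YF.1; [exact: Gx|exact: Gy].
Qed.

Lemma sub_generated : F `<=` generated F.
Proof. exact: sub_smallest. Qed.

Definition generated_struct : omstruct := {|
  dom := {x : M | generated F x};
  ple := fun x y => ple (sval x) (sval y);
  pmeet := fun x y => exist _ (pmeet (sval x) (sval y))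
    (generated_substructure (proj2_sig x) (proj2_sig y)) |}.

Lemma sval_generated_inj (x y : generated_struct) : sval x = sval y -> x = y.
Proof.
case: x y => [x Gx] [y Gy] /= xy; subst y; congr exist; exact: Prop_irrelevance.
Qed.

Lemma age_generated : finite_set F -> age M generated_struct.
Proof.
move=> finF; split.
  exists [set u | F (sval u)]; split.
    by apply: finite_preimage finF => u v _ _; exact: sval_generated_inj.
  apply/esym/seteqP; split => // u _ Y [subY FY].
  (* [Z] is the image of [Y] in [M], a substructure containing [F]. *)
  pose Z := [set x | exists G : generated F x, Y (exist _ x G)].
  have [G YG] : Z (sval u).
    apply: (svalP u); split.
      move=> x y [Gx Yx] [Gy Yy].
      by exists (generated_substructure Gx Gy); exact: (subY _ _ Yx Yy).
    by move=> x Fx; exists (sub_generated Fx); exact: FY.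
  by have <- // : exist _ (sval u) G = u by exact: sval_generated_inj.
exists sval => x y _ _; split => //.
exact: sval_generated_inj.
Qed.

End Generated.

(** Each axiom can be checked on at most three points at a time, inside the structure they generate,
    which is in the age and hence in [K]. *)
Lemma fraisse_pseudotree (K : omstruct -> Prop) (M : omstruct) :
  (forall A, K A -> pseudotree A) -> fraisse_limit K M -> pseudotree M.
Proof.
move=> Kp [_ Kage _].
have gen (x y z : M) : exists S : omstruct, exists2 h : S -> M,
    pseudotree S /\ embedding h &
    exists x' y' z', [/\ h x' = x, h y' = y & h z' = z].
  pose F := [set x; y; z].
  exists (generated_struct F), sval.
    split; last by move=> u v _ _; split => //; exact: sval_generated_inj.
    apply: Kp; apply/Kage/age_generated.
    by rewrite !finite_setU; split; [split|]; exact: finite_set1.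
  have Gx : generated F x by apply: sub_generated; left; left.
  have Gy : generated F y by apply: sub_generated; left; right.
  have Gz : generated F z by apply: sub_generated; right.
  by exists (exist _ x Gx), (exist _ y Gy), (exist _ z Gz).
split.
- move=> x; have [S [h [pS eh] [x' [_ [_ [<- _ _]]]]]] := gen x x x.
  by apply/(embedding_ple eh)/(ple_refl pS).
- move=> x y; have [S [h [pS eh] [x' [y' [_ [<- <- _]]]]]] := gen x y y.
  move=> /(embedding_ple eh) xy /(embedding_ple eh) yx.
  by rewrite (ple_anti pS xy yx).
- move=> x y z; have [S [h [pS eh] [x' [y' [z' [<- <- <-]]]]]] := gen x y z.
  move=> /(embedding_ple eh) xy /(embedding_ple eh) yz.
  by apply/(embedding_ple eh); exact: (ple_trans pS) xy yz.
- move=> a b; split.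
    move=> z; have [S [h [pS eh] [a' [b' [z' [<- <- <-]]]]]] := gen a b z.
    move=> [/(embedding_ple eh) za /(embedding_ple eh) zb].
    by rewrite -(embedding_meet eh); apply/(embedding_ple eh); exact: ple_meet.
  (* The meet itself belongs to the set, so any upper bound [u] is above it. *)
  move=> u; apply.
  have [S [h [pS eh] [a' [b' [_ [<- <- _]]]]]] := gen a b b.
  rewrite -(embedding_meet eh); split; apply/(embedding_ple eh).
    exact: pmeet_lel.
  exact: pmeet_ler.
- move=> a x y; have [S [h [pS eh] [a' [x' [y' [<- <- <-]]]]]] := gen a x y.
  move=> /(embedding_ple eh) xa /(embedding_ple eh) ya.
  have [xy|yx] := down_linear pS xa ya; [left|right];
    exact/(embedding_ple eh).
Qed.

(** * Dense branching of the Fraïssé limits *)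

Definition fork_le (x y : bool * bool) : bool :=
  [|| x == (false, false), x == y | (x == (false, true)) && y.1].

(* A chain (false, false) < (false, true) < (true, false) together with a
   further element (true, true) whose meet with the top is (false, true). *)
Definition fork : omstruct := {|
  dom := (bool * bool)%type;
  ple := fork_le;
  pmeet := fun x y => if fork_le x y then x else
    if fork_le y x then y else (false, true) |}.

Lemma fork_pseudotree : finite_binary_pseudotree fork.
Proof.
split; first split.
- exact: (@finite_finset (bool * bool)%type).
- split.
  + by move=> [[] []].
  + by move=> [[] []] [[] []].
  + by move=> [[] []] [[] []] [[] []].
  + move=> a b; split.
      by move: a b => [[] []] [[] []] [[] []] [].
    by move: a b => [[] []] [[] []] u; apply.
  + move=> a x y xa ya; apply/orP.
    by move: a x y xa ya => [[] []] [[] []] [[] []].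
- move=> a x y z [ax nax] [ay nay] [az naz].
  by case: a ax nax ay nay az naz => [[] []]; case: x => [[] []] //;
     case: y => [[] []] //; case: z => [[] []] // ? ? ? ? ? ? [].
Qed.

(** By homogeneity an automorphism carries [b] and [d] to the ends of the chain in an embedded
    [fork]; the preimages of the other two points are [c] and [x]. *)
Lemma fraisse_fork (K : omstruct -> Prop) (M : omstruct) : K fork ->
  pseudotree M -> fraisse_limit K M ->
  (exists b d : M, plt b d) /\ densely_branching M.
Proof.
move=> Kfork pM [_ Kage homM].
have [_ [h eh]] := (Kage fork).1 Kfork.
have hle := embedding_ple eh; have hI := embedding_inj eh.
have hm := embedding_meet eh.
have hlt u v : fork_le u v -> u != v -> plt (h u) (h v).
  by move=> uv /eqP nuv; split; [exact/hle|move/hI].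
split; first by exists (h (false, false)), (h (true, false)); exact: hlt.
move=> b d bd.
pose X := [set b; d].
have subX : substructure X.
  move=> x y [->|->] [->|->].
  - by left; rewrite (ple_meet_eq pM (ple_refl pM b)).
  - by left; rewrite (ple_meet_eq pM bd.1).
  - by left; rewrite pmeetC // (ple_meet_eq pM bd.1).
  - by right; rewrite (ple_meet_eq pM (ple_refl pM d)).
have genX : finitely_generated X.
  exists X; split; first by rewrite finite_setU; split; exact: finite_set1.
  apply/seteqP; split; first exact: sub_generated.
  by move=> x; apply; split.
pose k x := if pselect (x = b) then h (false, false) else h (true, false).
have kb : k b = h (false, false) by rewrite /k; case: pselect.
have kd : k d = h (true, false).
  by rewrite /k; case: pselect => // db; case: bd.2.
have nb u : h u <> h (~~ u.1, u.2) by move=> /hI; case: u => [[] []].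
have ek : embedding_on X k.
  move=> x y [->|->] [->|->]; rewrite ?kb ?kd.
  - rewrite !(ple_meet_eq pM (ple_refl pM _)) kb.
    by split => //; split=> _; exact: (ple_refl pM).
  - rewrite (ple_meet_eq pM bd.1) kb -hm; split => //.
      by move=> /nb.
    by split=> _; [exact: bd.1|exact/hle].
  - rewrite pmeetC // (ple_meet_eq pM bd.1) kb -hm; split => //.
      by move=> /nb.
    by split=> [/hle //|/(plt_nge pM bd)].
  - rewrite !(ple_meet_eq pM (ple_refl pM _)) kd.
    by split => //; split=> _; exact: (ple_refl pM).
have [H [[eH sH] Hk]] := homM _ _ genX ek.
have Hb : H b = h (false, false) by rewrite Hk ?kb //; left.
have Hd : H d = h (true, false) by rewrite Hk ?kd //; right.
have [c _ Hc] : range H (h (false, true)) by rewrite sH.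
have [x _ Hx] : range H (h (true, true)) by rewrite sH.
have HI := embedding_inj eH; have Hle := embedding_ple eH.
have Hm := embedding_meet eH.
have Hlt u v : plt (H u) (H v) -> plt u v.
  by move=> [/Hle uv nuv]; split => // uv'; apply: nuv; rewrite uv'.
exists c, x; split.
- by apply: Hlt; rewrite Hb Hc; exact: hlt.
- by apply: Hlt; rewrite Hc Hd; exact: hlt.
- by apply: HI; rewrite Hm Hx Hd Hc -hm.
- by move=> /Hle; rewrite Hx Hd => /hle.
Qed.

Lemma psi_properties (psi : omstruct) : is_psi_omega psi \/ is_psi_2 psi ->
  [/\ countable [set: psi], pseudotree psi, exists b d : psi, plt b d &
      densely_branching psi].
Proof.
suff H K : (forall A, K A -> pseudotree A) -> K fork -> fraisse_limit K psi ->
    [/\ countable [set: psi], pseudotree psi, exists b d : psi, plt b d &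
        densely_branching psi].
  have forkP := fork_pseudotree.
  case; apply: H; [by move=> A []|exact: forkP.1|by move=> A [[]]|exact: forkP].
move=> Kp Kfork lim; have pT := fraisse_pseudotree Kp lim.
by have [neT bT] := fraisse_fork Kfork pT lim; have [cT _ _] := lim.
Qed.

(** * Copies of the three element tree and its big Ramsey degree *)

Lemma three_tree_copy (T : omstruct) (C : set T) a b : pseudotree T ->
  substructure C -> C a -> C b -> incomparable a b ->
  copies three_tree C [set pmeet a b; a; b].
Proof.
move=> pT subC Ca Cb [ab ba].
have nab : a <> b by move=> e; apply: ab; rewrite e; exact: (ple_refl pT).
have [ma mb] : pmeet a b <> a /\ pmeet a b <> b.
  by split=> e; [apply: ab|apply: ba]; rewrite -e;
     (exact: pmeet_lel || exact: pmeet_ler).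
split; first by move=> x [[->|->]|->] //; exact: subC.
pose g (x : three_tree) :=
  if x is Some i then (if i then b else a) else pmeet a b.
have la : ple (pmeet a b) a := pmeet_lel pT.
have lb : ple (pmeet a b) b := pmeet_ler pT.
have nla : ~ ple a (pmeet a b) by move=> /(ple_anti pT la).
have nlb : ~ ple b (pmeet a b) by move=> /(ple_anti pT lb).
have rf := ple_refl pT.
exists g; split.
  move=> x y _ _; split.
  - by case: x y => [[]|] [[]|] //= e;
      first [by case: nab|by case: ma|by case: mb].
  - split; last by case=> ->; [case: y => [[]|]|exact: rf].
    by case: x y => [[]|] [[]|] //= _; (by left) || by right.
  - case: x y => [[]|] [[]|] /=; rewrite ?(ple_meet_eq pT (rf _)) //.
    + by rewrite pmeetC.
    + by rewrite (pmeetC pT b) (ple_meet_eq pT lb).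
    + by rewrite (pmeetC pT a (pmeet _ _)) (ple_meet_eq pT la).
    + by rewrite (ple_meet_eq pT lb).
    + by rewrite (ple_meet_eq pT la).
apply/seteqP; split => [_ [[[]|] _ <-] /=|x].
- by right.
- by left; right.
- by left; left.
- by case=> [[->|->]|->]; [exists None|exists (Some false)|exists (Some true)].
Qed.

(** A copy determines its incomparable pair up to order; as [osc] is symmetric, the colour below
    does not depend on the chosen pair. *)
Lemma incomparable_three (T : omstruct) (a b x y : T) : pseudotree T ->
  [set pmeet a b; a; b] x -> [set pmeet a b; a; b] y -> incomparable x y ->
  (x = a /\ y = b) \/ (x = b /\ y = a).
Proof.
move=> pT; have rf := ple_refl pT.
have la : ple (pmeet a b) a := pmeet_lel pT.
have lb : ple (pmeet a b) b := pmeet_ler pT.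
by move=> [[->|->]|->] [[->|->]|->] [xy yx]; try by [left|right];
  case: (xy (rf _)) || case: xy || case: yx.
Qed.

Lemma three_tree_degree (psi : omstruct) : is_psi_omega psi \/ is_psi_2 psi ->
  big_ramsey_degree psi three_tree = None.
Proof.
move=> /psi_properties[cT pT neT bT].
have [r lr] := countable_labelling pT cT.
rewrite /big_ramsey_degree; case: pselect => // h; exfalso.
have [l /asboolP arr] := h.
pose o a b := osc (labels r a `\` labels r b) (labels r b `\` labels r a).
have oC a b : o a b = o b a by exact: oscC.
(* The predecessor shifts the attained oscillations [1, 2, ...] to start at the colour [0];
   reduction modulo [l.+1] keeps all colours in range, and every copy of [psi] then shows each of
   them. *)
pose pair (X : set psi) := [set n | exists a b,
  [/\ X a, X b, incomparable a b & n = (o a b).-1]].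
pose c X := xget 0 (pair X) %% l.+1.
have [|C [[_ [g [eg gC]]]]] := arr c; first by move=> X _; exact: ltn_pmod.
apply; apply/seteqP; split => [_ [X _ <-]|k /= kl]; first exact: ltn_pmod.
have [x [y [ixy oxy]]] := osc_labels pT bT lr eg neT (ltn0Sn k).
have subC : substructure C.
  move=> u v; rewrite -gC => -[u' _ <-] [v' _ <-].
  by exists (pmeet u' v') => //; exact: embedding_meet.
have Cg z : C (g z) by rewrite -gC; exists z.
exists [set pmeet (g x) (g y); g x; g y]; first exact: three_tree_copy.
rewrite /c; case: xgetP => [n _ [a [b [Xa Xb iab ->]]]|].
  have -> : o a b = k.+1; last by rewrite modn_small.
  rewrite -oxy.
  by case: (incomparable_three pT Xa Xb iab) => -[-> ->] //; rewrite oC.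
move=> /(_ k); case; exists (g x), (g y); split => //.
- by left; right.
- by right.
- by rewrite /o oxy.
Qed.

Theorem theorem10 :
  (forall (psi : omstruct), is_psi_omega psi \/ is_psi_2 psi ->
   forall (f : nat -> psi + set psi), enumerating f ->
   forall (phi : set psi), copies psi [set: psi] phi ->
   forall l : nat, (1 <= l)%N ->
   exists a b : psi,
     [/\ phi a, phi b, incomparable a b & os f a b = l]) /\
  (forall psi2 : omstruct, is_psi_2 psi2 ->
     big_ramsey_degree psi2 three_tree = None) /\
  (forall psiomega : omstruct, is_psi_omega psiomega ->
     big_ramsey_degree psiomega three_tree = None).
Proof.
split; last first.
  by split=> psi lim; apply: three_tree_degree; [right|left].
move=> psi /psi_properties[_ pT neT bT] f ef phi [_ [g [eg gphi]]] l l1.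
have [r lr pE] := enumerating_labelling pT ef.
have [x [y [ixy oxy]]] := osc_labels pT bT lr eg neT l1.
exists (g x), (g y); split => //.
- by rewrite -gphi; exists x.
- by rewrite -gphi; exists y.
- by rewrite /os !pE.
Qed.
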